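(* Let $\mathcal{V}$ be a vector space over an algebraically closed field $\mathbb{F}$, let $\mathcal{D}:\mathcal{V}\to\mathcal{V}$ be a linear endomorphism, and let $P=P[\mathcal{D}]$ where $P[x]\in\mathbb{F}[x]$ is a nonconstant polynomial. Then $(\mu,u)$, with $\mu\in\mathbb{F}$ and $u\in\mathcal{V}$, is an eigenvalue, eigenvector pair for $P$ if and only if for some $k\in\{1,\ldots,\deg(P)\}$ $$u=u_1+\cdots+u_k,\qquad0\ne u_i,\quad i=1,\ldots,k,$$ where, for each $i\in\{1,\ldots,k\}$, $(\mathcal{D}-\lambda_i)^{p_i}u_i=0$ and $\lambda_i\in\mathbb{F}$ is a multiplicity $p_i$ solution of the polynomial equation $P[x]-\mu=0$, with $\lambda_1,\ldots,\lambda_k$ mutually distinct.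
   Context: $P[\mathcal{D}]$ is obtained from $P[x]$ by substituting $\mathcal{D}$ for $x$. $(\mu,u)$ is an eigenvalue, eigenvector pair for $P$ if $u\ne0$ and $Pu=\mu u$. *)

(* Defs.v *)
From HB Require Import structures.
From mathcomp Require Import all_boot all_order all_algebra.

Set Implicit Arguments.
Unset Strict Implicit.
Unset Printing Implicit Defensive.

Import GRing.Theory.
Local Open Scope ring_scope.

(* The library's [horner_alg] and ['End(V)] do not apply here: the former needs
   an algebra of endomorphisms and the latter a finite-dimensional space. *)
Definition poly_op (F : fieldType) (V : lmodType F) (P : {poly F})
    (D : {linear V -> V}) (u : V) : V :=
  \sum_(i < size P) P`_i *: iter i D u.

Fact poly_op_is_linear (F : fieldType) (V : lmodType F) (P : {poly F})
    (D : {linear V -> V}) : linear (poly_op P D).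
Proof.
move=> a u v; rewrite /poly_op scaler_sumr -big_split /=.
apply: eq_bigr => i _.
have -> : iter i D (a *: u + v) = a *: iter i D u + iter i D v.
  by elim: (i : nat) => //= n ->; rewrite linearP.
by rewrite scalerDr !scalerA mulrC.
Qed.

HB.instance Definition _ (F : fieldType) (V : lmodType F) (P : {poly F})
    (D : {linear V -> V}) :=
  GRing.isLinear.Build F V V *:%R (poly_op P D) (poly_op_is_linear P D).

Definition eigenpair (F : fieldType) (V : lmodType F) (T : {linear V -> V})
    (mu : F) (u : V) : Prop :=
  u != 0 /\ T u = mu *: u.

(* (D - lambda)^p, as a p-fold iterate. *)
Definition shift_iter (F : fieldType) (V : lmodType F) (D : {linear V -> V})
    (lambda : F) (p : nat) : V -> V :=
  iter p (fun v => D v - lambda *: v).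

(* [mup x q] is 0 when x is not a root of q, hence the separate root condition. *)
Definition root_mult (F : fieldType) (q : {poly F}) (x : F) (p : nat) : Prop :=
  root q x /\ mup x q = p.

(* Main.v *)
Require Import Defs.
From HB Require Import structures.
From mathcomp Require Import all_boot all_order all_algebra.

Set Implicit Arguments.
Unset Strict Implicit.
Unset Printing Implicit Defensive.

Import GRing.Theory.
Local Open Scope ring_scope.

(** An eigenvector of [P[D]] for [mu] is a nonzero vector killed by [q[D]],
    where [q := P - mu].  The map [p |-> p[D]] turns [V] into a module over the
    principal ideal domain [{poly F}], and [q] factors as a constant times the
    product of the pairwise coprime powers [('X - z) ^+ mup z q], [z] running
    through its distinct roots.  By the Chinese remainder principle the kernel
    of [q[D]] is then the direct sum of the kernels of these powers:
    Bezout identities split a vector into components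
    ([poly_op_coprime_split]), and show that components which add up to zero
    are all zero ([poly_op_coprime_indep]).

    From left to right, the vector is split along all the distinct roots of [q]
    and the zero components are dropped; at least one component remains since
    the vector is nonzero, and there are at most [deg q = deg P] of them.  From
    right to left, each component is killed by a divisor of [q], and a sum of
    nonzero components is nonzero by independence. *)

(** * Polynomials in an endomorphism as a ring action *)

Section PolyOpAction.
Variables (F : fieldType) (V : lmodType F) (D : {linear V -> V}).
Implicit Types (p q : {poly F}) (u v : V).

(** A common summation bound is what makes [poly_op] visibly additive in the
    polynomial, as [size] is not additive. *)
Lemma poly_op_widen n p u : (size p <= n)%N ->
  poly_op p D u = \sum_(i < n) p`_i *: iter i D u.
Proof.
move=> le_p_n.
rewrite /poly_op (big_ord_widen n (fun i => p`_i *: iter i D u) le_p_n).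
rewrite big_mkcond; apply: eq_bigr => i _; case: ltnP => // le_p_i.
by rewrite nth_default // scale0r.
Qed.

Lemma poly_opD p q u : poly_op (p + q) D u = poly_op p D u + poly_op q D u.
Proof.
pose n := maxn (size p) (size q).
rewrite (poly_op_widen u (size_polyD p q : size _ <= n)%N).
rewrite (poly_op_widen u (leq_maxl _ _ : size p <= n)%N).
rewrite (poly_op_widen u (leq_maxr _ _ : size q <= n)%N) -big_split /=.
by apply: eq_bigr => i _; rewrite coefD scalerDl.
Qed.

Lemma poly_opC c u : poly_op c%:P D u = c *: u.
Proof.
by rewrite (poly_op_widen u (size_polyC_leq1 c : _ <= 1)%N) big_ord1 coefC.
Qed.

Lemma poly_opMX p u : poly_op (p * 'X) D u = poly_op p D (D u).
Proof.
have le_pX : (size (p * 'X)%R <= (size p).+1)%N.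
  by rewrite (leq_trans (size_polyMleq _ _)) // size_polyX addn2.
rewrite (poly_op_widen u le_pX) big_ord_recl coefMX scale0r add0r.
by apply: eq_bigr => i _; rewrite coefMX /= -iterSr.
Qed.

Lemma poly_opZ c p u : poly_op (c *: p) D u = c *: poly_op p D u.
Proof.
rewrite (poly_op_widen u (size_scale_leq c p)) scaler_sumr.
by apply: eq_bigr => i _; rewrite coefZ scalerA.
Qed.

Lemma poly_opM p q u : poly_op (p * q) D u = poly_op p D (poly_op q D u).
Proof.
have comm_opD r v : poly_op r D (D v) = D (poly_op r D v).
  rewrite /poly_op linear_sum; apply: eq_bigr => i _.
  by rewrite linearZ /= -iterSr.
elim/poly_ind: p u => [|p c IHp] u;
  first by rewrite mul0r -polyC0 !poly_opC !scale0r.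
rewrite mulrDl mul_polyC -mulrA -commr_polyX mulrA !poly_opD poly_opZ.
by rewrite !poly_opMX poly_opC IHp comm_opD.
Qed.

Lemma shift_iterE c n v :
  shift_iter D c n v = poly_op (('X - c%:P) ^+ n) D v.
Proof.
elim: n => [|n IHn]; first by rewrite expr0 poly_opC scale1r.
rewrite exprS poly_opM -IHn -polyCN poly_opD poly_opC -['X]mul1r poly_opMX.
by rewrite poly_opC scale1r scaleNr.
Qed.

Lemma eigenpairE p mu u :
  eigenpair (poly_op p D) mu u <-> u != 0 /\ poly_op (p - mu%:P) D u = 0.
Proof.
rewrite /eigenpair -polyCN poly_opD poly_opC scaleNr.
by split=> -[-> /eqP pu]; split=> //; apply/eqP; rewrite subr_eq0 in pu *.
Qed.

Lemma poly_op_dvd0 p q u : p %| q -> poly_op p D u = 0 -> poly_op q D u = 0.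
Proof. by case/dvdpP=> r -> pu0; rewrite poly_opM pu0 linear0. Qed.

(** * Direct sums along coprime polynomials *)

Lemma coprimep_prod (I : eqType) (s : seq I) (r : I -> {poly F}) p :
  {in s, forall i, coprimep p (r i)} -> coprimep p (\prod_(i <- s) r i).
Proof.
move=> co_p_r; rewrite big_seq.
elim/big_ind: _ => [|x y|//]; first exact: coprimep1.
by rewrite coprimepMr => -> ->.
Qed.

(** If [a p + b q = 1], then [u = a p u + b q u], where [q] kills the first
    term and [p] the second; the product is split one factor at a time. *)
Lemma poly_op_coprime_split (I : eqType) (s : seq I) (r : I -> {poly F}) u :
    uniq s -> {in s &, forall i j, i != j -> coprimep (r i) (r j)} ->
    poly_op (\prod_(i <- s) r i) D u = 0 ->
  exists2 v : I -> V, u = \sum_(i <- s) v i &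
    {in s, forall i, poly_op (r i) D (v i) = 0}.
Proof.
elim: s u => [|i s IHs] u /=.
  rewrite big_nil poly_opC scale1r => _ _ ->.
  by exists (fun=> 0); rewrite ?big_nil.
case/andP=> i_s uniq_s co_r; rewrite big_cons; set h := \prod_(j <- s) r j.
move=> rhu0.
have neq_i j : j \in s -> i != j by move=> js; apply: contraNneq i_s => ->.
have: coprimep (r i) h.
  apply: coprimep_prod => j js; apply: co_r (neq_i j js) => //.
    exact: mem_head.
  by rewrite inE js orbT.
case/Bezout_eq1_coprimepP=> -[a b] /= bezout.
have [||v vE v0] := IHs (poly_op (a * r i) D u) uniq_s.
- by move=> j k js ks; apply: co_r; rewrite inE ?js ?ks orbT.
- by rewrite -poly_opM mulrCA [h * _]mulrC poly_opM rhu0 linear0.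
exists (fun j => if j == i then poly_op (b * h) D u else v j).
  rewrite big_cons eqxx -[LHS]scale1r -poly_opC polyC1 -bezout.
  rewrite poly_opD addrC vE.
  congr (_ + _); apply: eq_big_seq => j js.
  by rewrite eq_sym (negPf (neq_i j js)).
move=> j; rewrite inE; case: eqP => [-> _|_] /=; last exact: v0.
by rewrite -poly_opM mulrCA poly_opM rhu0 linear0.
Qed.

(** The product [h] of the other factors kills every component but the [j]-th,
    hence kills that one as well; so does [r j], which is coprime to [h]. *)
Lemma poly_op_coprime_indep (I : eqType) (s : seq I) (r : I -> {poly F})
    (v : I -> V) :
    uniq s -> {in s &, forall i j, i != j -> coprimep (r i) (r j)} ->
    {in s, forall i, poly_op (r i) D (v i) = 0} ->
    \sum_(i <- s) v i = 0 ->
  {in s, forall i, v i = 0}.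
Proof.
move=> uniq_s co_r v0 sum0 j js; pose h := \prod_(i <- rem j s) r i.
have rem_neq i : i \in rem j s -> (i != j) && (i \in s).
  by rewrite mem_rem_uniq // inE.
have: coprimep (r j) h.
  apply: coprimep_prod => i /rem_neq/andP[ij is_].
  by apply: co_r; rewrite // eq_sym.
case/Bezout_eq1_coprimepP=> -[a b] /= bezout.
have hv0 : poly_op h D (v j) = 0.
  have := congr1 (poly_op h D) sum0.
  rewrite (big_rem j js) linearD linear_sum linear0 /= big_seq big1 ?addr0 //.
  move=> i i_s; have /andP[_ is_] := rem_neq i i_s.
  by apply: poly_op_dvd0 (v0 i is_); rewrite /h (big_rem i i_s) dvdp_mulIl.
rewrite -[v j]scale1r -poly_opC polyC1 -bezout poly_opD !poly_opM v0 // hv0.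
by rewrite !linear0 addr0.
Qed.

End PolyOpAction.

(** * Factorization over an algebraically closed field *)

Lemma coprimep_XsubC_exp (F : fieldType) (a b : F) m n :
  a != b -> coprimep (('X - a%:P) ^+ m) (('X - b%:P) ^+ n).
Proof.
move=> ab; apply/coprimep_expl/coprimep_expr/coprimep_XsubC2.
by rewrite subr_eq0 eq_sym.
Qed.

Lemma closed_field_poly_mup (F : closedFieldType) (q : {poly F}) : q != 0 ->
  exists s : seq F, [/\ uniq s, {in s, forall z, root q z},
    (size s <= (size q).-1)%N &
    q = lead_coef q *: \prod_(z <- s) ('X - z%:P) ^+ mup z q].
Proof.
move=> q0; have lq0 : lead_coef q != 0 by rewrite lead_coef_eq0.
have [rs qE] := closed_field_poly_normal q; exists (undup rs).
have mupE z : mup z q = count_mem z rs.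
  rewrite qE -mul_polyC mupMr ?mu_prod_XsubC //.
  by rewrite rootC.
split; first exact: undup_uniq.
- by move=> z; rewrite mem_undup qE rootZ // root_prod_XsubC.
- by rewrite [in size q]qE size_scale // size_prod_XsubC size_undup.
rewrite {1}qE; congr (_ *: _); rewrite -prodr_undup_exp_count.
by apply: eq_bigr => z _; rewrite mupE.
Qed.

Theorem corollary3p8 (F : closedFieldType) (V : lmodType F)
    (D : {linear V -> V}) (P : {poly F}) (hP : (1 < size P)%N)
    (mu : F) (u : V) :
  eigenpair (poly_op P D) mu u <->
  exists k : nat, (1 <= k <= (size P).-1)%N /\
  exists (w : 'I_k -> V) (lambda : 'I_k -> F) (p : 'I_k -> nat),
    [/\ u = \sum_(i < k) w i,
        forall i, w i != 0,
        forall i, shift_iter D (lambda i) (p i) (w i) = 0,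
        forall i, root_mult (P - mu%:P) (lambda i) (p i)
      & injective lambda].
Proof.
apply: iff_trans (eigenpairE D P mu u) _; set q := P - mu%:P.
have size_q : size q = size P.
  by rewrite /q size_polyDl // size_polyN (leq_ltn_trans (size_polyC_leq1 _)).
have q0 : q != 0 by rewrite -size_poly_gt0 size_q ltnW.
split=> [[u0 qu0] | [k [/andP[k_gt0 _]]]].
  have [s [uniq_s root_s size_s qE]] := closed_field_poly_mup q0.
  have [||v uE v0] := poly_op_coprime_split (D := D) (u := u)
    (r := fun z => ('X - z%:P) ^+ mup z q) uniq_s.
  - by move=> a b _ _; apply: coprimep_XsubC_exp.
  - apply: poly_op_dvd0 qu0.
    by rewrite {1}qE dvdpZl ?lead_coef_eq0.
  pose t := [seq z <- s | v z != 0].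
  have uE_t : u = \sum_(z <- t) v z.
    rewrite big_filter uE [RHS]big_mkcond; apply: eq_bigr => z _.
    by case: eqP => [->|].
  have t_i (i : 'I_(size t)) : (t`_i \in s) && (v t`_i != 0).
    by have := mem_nth 0 (ltn_ord i); rewrite mem_filter andbC.
  exists (size t); split.
    rewrite -size_q (leq_trans _ size_s) ?size_filter ?count_size // andbT.
    rewrite -size_filter lt0n; apply: contraNneq u0 => /size0nil t0.
    by rewrite uE_t /t t0 big_nil.
  exists (fun i => v t`_i), (fun i => t`_i), (fun i => mup t`_i q); split.
  - by rewrite uE_t (big_nth 0) big_mkord.
  - by move=> i; case/andP: (t_i i).
  - by move=> i; rewrite shift_iterE v0 //; case/andP: (t_i i).
  - by move=> i; split=> //; apply: root_s; case/andP: (t_i i).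
  move=> i j /eqP; rewrite nth_uniq ?filter_uniq //.
  by move/eqP/val_inj.
case=> w [lambda [p [uE w0 Dw0 root_p inj_lambda]]].
pose r i := ('X - (lambda i)%:P) ^+ p i.
have rw0 i : poly_op (r i) D (w i) = 0 by rewrite -shift_iterE.
split; last first.
  rewrite uE linear_sum big1 // => i _; apply: poly_op_dvd0 (rw0 i).
  by rewrite -mup_geq //; case: (root_p i) => _ ->.
apply: contraTneq (w0 (Ordinal k_gt0)) => u0; rewrite negbK; apply/eqP.
apply: (poly_op_coprime_indep (D := D) (s := index_enum 'I_k) (r := r)) => //.
- exact: index_enum_uniq.
- by move=> i j _ _ ij; apply: coprimep_XsubC_exp; rewrite (inj_eq inj_lambda).
by rewrite -uE.
Qed.
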